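(* Let $\mu$ be any probability measure on $\mathbb{R}$ admitting a second moment. Let $f,g:\mathbb{R}\to\mathbb{R}$ be functions in $L^2(\mu)$, and let $x$ denote the identity function on $\mathbb{R}$. (1) If $f$ and $g$ are convex, then $$\mathrm{Var}(\mu)\,\mathrm{Cov}_\mu(f,g)\ \ge\ \mathrm{Cov}_\mu(f,x)\,\mathrm{Cov}_\mu(g,x).$$ (2) If $f$ is log-concave, $g$ is convex, and $f$ is orthogonal to the linear function $x$, i.e. $\mathrm{Cov}_\mu(f,x)=0$, then $$\mathrm{Cov}_\mu(f,g)\le 0.$$ (3) If $f$ and $g$ are quasi-concave and both even, then $$\mathrm{Cov}_\mu(f,g)\ge 0.$$
   Context: For a probability measure $\mu$ and $f,g\in L^2(\mu)$, $\mathrm{Cov}_\mu(f,g)=\int (f-\int f\,d\mu)(g-\int g\,d\mu)\,d\mu$. $\mathrm{Var}(\mu)=\mathrm{Cov}_\mu(x,x)$ is the variance of $\mu$. A function $f\ge 0$ is log-concave if $f(\lambda x+(1-\lambda)y)\ge f(x)^\lambda f(y)^{1-\lambda}$ for all $x,y$ and $\lambda\in[0,1]$. A real-valued function $f$ is quasi-concave if $f(\lambda x+(1-\lambda)y)\ge\min\{f(x),f(y)\}$ for all $x,y$ and $\lambda\in[0,1]$. Standing convention: functions are assumed to have enough integrability and regularity for all written quantities to be well defined. *)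

(* Defs.v *)
From mathcomp Require Import all_boot all_order all_algebra.
From mathcomp Require Import all_classical all_reals all_analysis.
Set Implicit Arguments.
Unset Strict Implicit.
Unset Printing Implicit Defensive.
Import Order.TTheory GRing.Theory Num.Theory.
Import numFieldNormedType.Exports.
Local Open Scope ring_scope.

(* [powR] satisfies 0 `^ 0 = 1, so the inequality is trivially true at l = 0
   and l = 1 even where f vanishes. *)
Definition log_concave (R : realType) (f : R -> R) : Prop :=
  (forall x, 0 <= f x) /\
  (forall x y l : R, 0 <= l <= 1 ->
    f x `^ l * f y `^ (1 - l) <= f (l * x + (1 - l) * y)).

Definition quasi_concave (R : realType) (f : R -> R) : Prop :=
  forall x y l : R, 0 <= l <= 1 ->
    Num.min (f x) (f y) <= f (l * x + (1 - l) * y).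

Definition even_function (R : realType) (f : R -> R) : Prop :=
  forall x : R, f (- x) = f x.

(* Main.v *)
Require Import Defs.
From mathcomp Require Import all_boot all_order all_algebra.
From mathcomp Require Import all_classical all_reals all_analysis.
From mathcomp Require Import measurable_realfun lra ring.
Import Order.TTheory GRing.Theory Num.Theory.
Import numFieldNormedType.Exports.
Local Open Scope classical_set_scope.
Local Open Scope ring_scope.
Local Open Scope ereal_scope.

(** All three covariance inequalities come from one remark: if [X] is
    uncorrelated with [Z], then
      Cov(X, Y) = Cov(X, Y - Z) = E[(X - E X) (Y - Z)],
    so the sign of Cov(X, Y) is known as soon as some [Z] uncorrelated with [X]
    makes the last integrand of constant sign
    ([covariance_sub_uncorrelated]).

    The core is [covariance_quasi_concave_convex_le0]: if [f] is quasi-concave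
    and uncorrelated with the identity, then Cov(f, g) <= 0 for every convex
    [g].  Here every affine function may serve as [Z].  Quasi-concavity makes
    the set [I] of points where [f] exceeds its mean an interval.  If [I] is
    nonempty and bounded, choose for [Z] the affine function that agrees with
    [g] at both endpoints of [I], or a supporting line of [g] when the endpoints
    coincide; then g - Z <= 0 on [I] and g - Z >= 0 off [I], so
    (f - E f) (g - Z) <= 0 everywhere.  If [I] is empty or unbounded, then
    f - E f has the sign of a nonzero affine function [Z]; as
    E[(f - E f) Z] = Cov(f, Z) = 0, the function f - E f vanishes almost
    everywhere except perhaps at the single zero of [Z], and Cov(f, g) = 0
    ([covariance_eq0_sign]).

    (2) follows because log-concave functions are quasi-concave.

    (1) follows by applying the core to the concave function
    h = Cov(f, x) x - Var(x) f, which is uncorrelated with the identity by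
    construction: Cov(h, g) <= 0 is the claim.  The division by the variance of
    a regression argument is avoided, so a degenerate measure needs no separate
    treatment.

    (3) holds because an even quasi-concave function is a nonincreasing function
    of the absolute value, so [f] and [g] are comonotone, and Chebyshev's
    association inequality applies ([covariance_comonotone_ge0]); there [Z] is a
    constant separating the values of [g] where [f] exceeds its mean from those
    where it does not. *)

(** * Convexity and quasi-concavity on the line *)

Section shapes.
Context {R : realType}.
Implicit Types f k : R -> R.
Local Open Scope ring_scope.

(** The geometric mean of two numbers is at least their minimum. *)
Lemma log_concave_quasi_concave f : log_concave f -> quasi_concave f.
Proof.
move=> [f0 fl] x y l l01; apply: le_trans (fl x y l l01).
have /andP[l0 l1] := l01.
set m := Num.min _ _.
have m0 : 0 <= m by rewrite le_min !f0.
have -> : m = m `^ l * m `^ (1 - l).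
  by rewrite -powRD addrC subrK ?oner_eq0 ?powRr1.
by rewrite ler_pM ?powR_ge0// ge0_ler_powR ?nnegrE ?f0 ?ge_min ?lexx ?orbT//;
  lra.
Qed.

Lemma quasi_concave_is_interval f c :
  quasi_concave f -> is_interval [set x | c < f x].
Proof.
move=> qf x y /= cx cy z /andP[xz zy].
have [xy|yx] := ltP x y; last first.
  by have -> : z = x by apply/eqP; rewrite eq_le xz (le_trans zy yx).
have d0 : 0 < y - x by rewrite subr_gt0.
have l01 : 0 <= (y - z) / (y - x) <= 1.
  by rewrite divr_ge0 ?ler_pdivrMr ?mul1r; lra.
apply: lt_le_trans (_ : Num.min (f x) (f y) <= _); first by rewrite lt_min cx.
apply: le_trans (qf x y _ l01) _.
rewrite le_eqVlt; apply/orP; left; apply/eqP; congr f; field.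
by rewrite gt_eqF.
Qed.

Lemma convex_function_le k : convex_function [set: R^o] k ->
  forall x y l, 0 <= l <= 1 ->
    k (l * x + (1 - l) * y) <= l * k x + (1 - l) * k y.
Proof.
move=> ck x y l /andP[l0 l1].
have := ck (Itv01 l0 l1) x y; rewrite !in_setT => /(_ isT isT).
by rewrite !convRE.
Qed.

(** Such a combination is concave, and a weighted mean of two numbers is at
    least their minimum. *)
Lemma quasi_concave_linear_add_concave f (c v : R) : v <= 0 ->
  convex_function [set: R^o] f -> quasi_concave (fun x => c * x + v * f x).
Proof.
move=> v0 /convex_function_le cf x y l /[dup] l01 /andP[l0 l1].
set m := Num.min _ _.
have mx : m <= c * x + v * f x by rewrite ge_min lexx.
have my : m <= c * y + v * f y by rewrite ge_min lexx orbT.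
have := ler_wnM2l v0 (cf x y l l01).
have := ler_wpM2l l0 mx.
have : (1 - l) * m <= (1 - l) * (c * y + v * f y).
  by rewrite ler_wpM2l// subr_ge0.
lra.
Qed.

(** The division-free form of convexity: weights proportional to the opposite
    segments, so that coincident points are allowed. *)
Lemma convex_chord k x y z : convex_function [set: R^o] k ->
  x <= y <= z -> k y * (z - x) <= k x * (z - y) + k z * (y - x).
Proof.
move=> /convex_function_le ck /andP[xy yz].
have [xz|zx] := ltP x z; last first.
  have -> : y = x by lra.
  have -> : z = x by lra.
  by lra.
have d0 : 0 < z - x by rewrite subr_gt0.
have l01 : 0 <= (z - y) / (z - x) <= 1.
  by rewrite divr_ge0 ?ler_pdivrMr ?mul1r; lra.
have := ck x z _ l01; rewrite -(ler_pM2r d0).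
have -> : (z - y) / (z - x) * x + (1 - (z - y) / (z - x)) * z = y.
  by field; rewrite gt_eqF.
move/le_trans; apply.
rewrite le_eqVlt; apply/orP; left; apply/eqP; field.
by rewrite gt_eqF.
Qed.

(** The slope is the supremum of the slopes of chords ending at [p] from the
    left, which are bounded by those of the chords leaving [p] to the right. *)
Lemma convex_subgradient k p : convex_function [set: R^o] k ->
  exists a, forall x, a * (x - p) <= k x - k p.
Proof.
move=> ck.
pose S := [set (k p - k x) / (p - x) | x in [set x | x < p]].
have S0 : S !=set0 by exists ((k p - k (p - 1)) / (p - (p - 1))), (p - 1) => //=; lra.
have ubS z : p < z -> ubound S ((k z - k p) / (z - p)).
  move=> pz _ [x /= xp <-].
  have xpz : x <= p <= z by rewrite !ltW.
  have := convex_chord k x p z ck xpz.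
  rewrite ler_pdivrMr ?subr_gt0// mulrAC ler_pdivlMr ?subr_gt0//.
  by lra.
have hS : has_ubound S by exists ((k (p + 1) - k p) / (p + 1 - p)); apply: ubS; lra.
exists (sup S) => x.
have [xp|px|->] := ltgtP x p; last by lra.
- have : (k p - k x) / (p - x) <= sup S by apply: ub_le_sup => //; exists x.
  by rewrite ler_pdivrMr ?subr_gt0//; lra.
- have : sup S <= (k x - k p) / (x - p) by apply: ge_sup => //; exact: ubS.
  by rewrite ler_pdivlMr ?subr_gt0.
Qed.

(** For p < q this is the chord through [p] and [q]; for p = q, where the first
    condition only fixes the value at [p], it is a supporting line. *)
Lemma convex_affine_touching k p q : convex_function [set: R^o] k -> p <= q ->
  exists a b, forall x, (p <= x <= q -> k x <= a * x + b) /\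
    (x <= p \/ q <= x -> a * x + b <= k x).
Proof.
move=> ck; rewrite le_eqVlt => /predU1P[<-|pq].
  have [a ha] := convex_subgradient k p ck.
  exists a, (k p - a * p) => x; split => [xp|_].
    have -> : x = p by lra.
    by lra.
  by have := ha x; lra.
exists ((k q - k p) / (q - p)), (k p - (k q - k p) / (q - p) * p) => x.
have d0 : 0 < q - p by rewrite subr_gt0.
have -> : (k q - k p) / (q - p) * x + (k p - (k q - k p) / (q - p) * p) =
  (k p * (q - x) + k q * (x - p)) / (q - p) by field; rewrite gt_eqF.
rewrite ler_pdivlMr// ler_pdivrMr//; split; first exact: convex_chord.
move=> [xp|qx].
- have xpq : x <= p <= q by rewrite xp ltW.
  by have := convex_chord k x p q ck xpq; lra.
- have pqx : p <= q <= x by rewrite qx ltW.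
  by have := convex_chord k p q x ck pqx; lra.
Qed.

(** [x] lies between [|y|] and [-|y|], two points where [f] takes the value
    [f y]. *)
Lemma quasi_concave_even_le f x y :
  quasi_concave f -> even_function f -> `|x| <= `|y| -> f y <= f x.
Proof.
move=> qf ef xy.
have fa z : f `|z| = f z by case: (ger0P z).
have [y0|y0] := eqVneq `|y| 0.
  have x0 : `|x| = 0 by apply/le_anti; rewrite normr_ge0 -y0 xy.
  by rewrite -(fa x) -(fa y) x0 y0.
have yp : 0 < `|y| by rewrite lt_neqAle eq_sym y0 normr_ge0.
have l01 : 0 <= (1 + x / `|y|) / 2 <= 1.
  have : `|x / `|y| | <= 1 by rewrite normrM normfV normr_id ler_pdivrMr ?mul1r.
  by rewrite ler_norml; lra.
have := qf `|y| (- `|y|) _ l01; rewrite ef minxx fa.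
suff -> : (1 + x / `|y|) / 2 * `|y| + (1 - (1 + x / `|y|) / 2) * - `|y| = x by [].
by field.
Qed.

End shapes.

(** * Covariances through uncorrelated corrections *)

Section covariance_sign.
Context {d} {T : measurableType d} {R : realType} (P : probability T R).
Implicit Types X Y Z : T -> R.

Lemma Lfun2_sub1 X : X \in Lfun P 2%:E -> X \in Lfun P 1.
Proof. by apply: Lfun_subset12; exact: fin_num_measure. Qed.

Lemma covariance_fin_num2 X Y :
  X \in Lfun P 2%:E -> Y \in Lfun P 2%:E -> covariance P X Y \is a fin_num.
Proof.
by move=> X2 Y2; rewrite covariance_fin_num ?Lfun2_mul_Lfun1 ?Lfun2_sub1.
Qed.

Lemma Lfun2_lin X Y (a b : R) :
    X \in Lfun P 2%:E -> Y \in Lfun P 2%:E ->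
  (fun x => a * X x + b * Y x)%R \in Lfun P 2%:E.
Proof.
move=> X2 Y2.
have aX2 : (a \o* X)%R \in Lfun P 2%:E by rewrite Lfun_scale ?ler1n.
have bY2 : (b \o* Y)%R \in Lfun P 2%:E by rewrite Lfun_scale ?ler1n.
have -> : (fun x => a * X x + b * Y x)%R = ((a \o* X) \+ (b \o* Y))%R.
  by apply/funext => x /=; rewrite (mulrC a) (mulrC b).
by rewrite rpredD ?lee1n.
Qed.

Lemma covariance_linl X Y Z (a b : R) :
    X \in Lfun P 2%:E -> Y \in Lfun P 2%:E -> Z \in Lfun P 2%:E ->
  covariance P (fun x => a * X x + b * Y x)%R Z =
    a%:E * covariance P X Z + b%:E * covariance P Y Z.
Proof.
move=> X2 Y2 Z2.
have -> : (fun x => a * X x + b * Y x)%R = ((a \o* X) \+ (b \o* Y))%R.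
  by apply/funext => x /=; rewrite (mulrC a) (mulrC b).
rewrite covarianceDl ?Lfun_scale ?ler1n//.
by rewrite !covarianceZl ?Lfun2_mul_Lfun1 ?Lfun2_sub1.
Qed.

Lemma Lfun2_affine X (a b : R) : X \in Lfun P 2%:E ->
  (fun x => a * X x + b)%R \in Lfun P 2%:E.
Proof.
move=> X2.
have -> : (fun x => a * X x + b)%R = (fun x => a * X x + b * cst 1 x)%R.
  by apply/funext => x; rewrite /= mulr1.
by apply: Lfun2_lin => //; exact: Lfun_cst.
Qed.

Lemma covariance_affine_eq0 X Y (a b : R) :
    X \in Lfun P 2%:E -> Y \in Lfun P 2%:E -> covariance P X Y = 0 ->
  covariance P X (fun x => a * Y x + b)%R = 0.
Proof.
move=> X2 Y2 XY.
have -> : (fun x => a * Y x + b)%R = (fun x => a * Y x + b * cst 1 x)%R.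
  by apply/funext => x; rewrite /= mulr1.
rewrite covarianceC covariance_linl ?Lfun_cst// covariance_cst_l mule0 adde0.
by rewrite covarianceC XY mule0.
Qed.

(** Subtracting [Z] from [Y] does not change the covariance, and once [X] is
    centered there is no need to center Y - Z. *)
Lemma covariance_sub_uncorrelated X Y Z :
    X \in Lfun P 2%:E -> Y \in Lfun P 2%:E -> Z \in Lfun P 2%:E ->
    covariance P X Z = 0 ->
  covariance P X Y = 'E_P[((X \- cst (fine 'E_P[X])) \* (Y \- Z))%R].
Proof.
move=> X2 Y2 Z2 XZ.
have W2 : (Y \- Z)%R \in Lfun P 2%:E by rewrite rpredB ?lee1n.
have [X1 W1] := (Lfun2_sub1 X X2, Lfun2_sub1 _ W2).
have XW1 := Lfun2_mul_Lfun1 X2 W2.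
rewrite -[LHS]sube0 -XZ -covarianceBr// covarianceE//.
have -> : ((X \- cst (fine 'E_P[X])) \* (Y \- Z) =
   (X \* (Y \- Z)) \- (fine 'E_P[X] \o* (Y \- Z)))%R.
  by apply/funext => x /=; rewrite mulrBl [(fine _ * _)%R]mulrC.
rewrite [RHS]expectationB ?Lfun_scale// expectationZl//.
by rewrite fineK// expectation_fin_num.
Qed.

Lemma covariance_ge0_sign X Y Z :
    X \in Lfun P 2%:E -> Y \in Lfun P 2%:E -> Z \in Lfun P 2%:E ->
    covariance P X Z = 0 ->
    (forall x, 0 <= (X x - fine 'E_P[X]) * (Y x - Z x))%R ->
  0 <= covariance P X Y.
Proof.
move=> X2 Y2 Z2 XZ s.
by rewrite (covariance_sub_uncorrelated X Y Z)//; exact: expectation_ge0.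
Qed.

Lemma covariance_le0_sign X Y Z :
    X \in Lfun P 2%:E -> Y \in Lfun P 2%:E -> Z \in Lfun P 2%:E ->
    covariance P X Z = 0 ->
    (forall x, (X x - fine 'E_P[X]) * (Y x - Z x) <= 0)%R ->
  covariance P X Y <= 0.
Proof.
move=> X2 Y2 Z2 XZ s.
have Y2' : (\- Y)%R \in Lfun P 2%:E by rewrite rpredN.
have Z2' : (\- Z)%R \in Lfun P 2%:E by rewrite rpredN.
rewrite -oppe_ge0 -covarianceNr ?Lfun2_mul_Lfun1 ?Lfun2_sub1//.
apply: (covariance_ge0_sign X (\- Y)%R (\- Z)%R) => //.
  by rewrite covarianceNr ?XZ ?oppe0 ?Lfun2_mul_Lfun1 ?Lfun2_sub1.
by move=> x /=; have := s x; lra.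
Qed.

(** The degenerate case of the sign argument.  A nonnegative function
    (X - E X) Z of zero integral vanishes almost everywhere, so X - E X can only
    live where [Z] vanishes; there [Y] is the constant [c], and
    (X - E X) (Y - c) is zero almost everywhere. *)
Lemma covariance_eq0_sign X Y Z c :
    X \in Lfun P 2%:E -> Y \in Lfun P 2%:E -> Z \in Lfun P 2%:E ->
    covariance P X Z = 0 ->
    (forall x, 0 <= (X x - fine 'E_P[X]) * Z x)%R ->
    (forall x, Z x = 0%R -> Y x = c) ->
  covariance P X Y = 0.
Proof.
move=> X2 Y2 Z2 XZ; set e := fine 'E_P[X] => s Zc.
have c2 r : cst r \in Lfun P 2%:E by exact: Lfun_cst.
have m X' : X' \in Lfun P 2%:E -> measurable_fun setT X'.
  by move=> /sub_Lfun_mfun; rewrite inE.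
have mul_m X' Y' : X' \in Lfun P 2%:E -> Y' \in Lfun P 2%:E ->
    measurable_fun setT (X' \* Y')%R.
  by move=> ? ?; apply: measurable_funM; exact: m.
have XE2 : (X \- cst (e))%R \in Lfun P 2%:E by rewrite rpredB ?lee1n.
have : ae_eq P setT (EFin \o ((X \- cst (e)) \* Z)%R) (cst 0).
  apply/ae_eq_integral_abs => //; first exact/measurable_EFinP/mul_m.
  rewrite -[RHS]XZ (covariance_sub_uncorrelated X Z (cst 0%R))//; last first.
    exact: covariance_cst_r.
  rewrite -/e unlock; apply: eq_integral => x _ /=.
  by rewrite subr0 ger0_norm.
move=> XZ0; rewrite (covariance_sub_uncorrelated X Y (cst c))//; last first.
  exact: covariance_cst_r.
rewrite -/e unlock (@ae_eq_integral _ _ _ _ _ (cst 0)) ?integral0//.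
  by apply/measurable_EFinP/mul_m => //; rewrite rpredB ?lee1n.
apply: filterS XZ0 => x /= /(_ I) [] /eqP; rewrite mulf_eq0.
by move=> /orP[/eqP ->|/eqP/Zc ->] _; rewrite ?mul0r// subrr mulr0.
Qed.

(** Chebyshev's association inequality, without the usual double integral: a
    constant separates the values of [Y] on the two sides of the event that [X]
    exceeds its mean. *)
Lemma covariance_comonotone_ge0 X Y :
    X \in Lfun P 2%:E -> Y \in Lfun P 2%:E ->
    (forall x y, (X x < X y)%R -> (Y x <= Y y)%R) ->
  0 <= covariance P X Y.
Proof.
move=> X2 Y2 XY; set m := fine 'E_P[X].
have c2 r : cst r \in Lfun P 2%:E by exact: Lfun_cst.
(* if X never crosses its mean m, it equals m almost everywhere *)
have one_side (e : R) : e != 0%R -> (forall x, 0 <= (X x - m) * e)%R ->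
    0 <= covariance P X Y.
  move=> e0 s; rewrite (covariance_eq0_sign X Y (cst e) 0)//.
    exact: covariance_cst_r.
  by move=> x /= /eqP; rewrite (negPf e0).
have [[y ym]|/forallNP B] := pselect (exists y, (m < X y)%R); last first.
  apply: (one_side (- 1)%R); first by rewrite oppr_eq0 oner_eq0.
  by move=> x; have /negP := B x; rewrite -leNgt; lra.
have [[x xm]|/forallNP A] := pselect (exists x, (X x <= m)%R); last first.
  apply: (one_side 1%R); first by rewrite oner_eq0.
  by move=> x; have /negP := A x; rewrite -ltNge; lra.
pose S := [set Y z | z in [set z | (X z <= m)%R]].
have ubS z : (m < X z)%R -> ubound S (Y z).
  by move=> mz _ [w /= wm <-]; apply: XY; exact: le_lt_trans mz.
have S0 : S !=set0 by exists (Y x), x.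
have hS : has_ubound S by exists (Y y); exact: ubS.
apply: (covariance_ge0_sign X Y (cst (sup S))) => //.
  exact: covariance_cst_r.
move=> z /=; have [zm|mz] := leP (X z) m.
- rewrite mulr_le0// subr_le0//.
  by apply: ub_le_sup => //; exists z.
- rewrite mulr_ge0// subr_ge0; first exact: ltW.
  by apply: ge_sup => //; exact: ubS.
Qed.

End covariance_sign.

(** * The line *)

Lemma Lfun2_sqr_integrable d (T : measurableType d) (R : realType)
    (mu : {measure set T -> \bar R}) (f : T -> R) :
  measurable_fun setT f -> mu.-integrable setT (fun x => (f x ^+ 2)%:E) ->
  f \in Lfun mu 2%:E.
Proof.
move=> mf /integrableP[_ f2]; rewrite inE; apply/andP; split; rewrite inE//=.
rewrite /finite_norm unlock /Lnorm poweR_lty//; apply: le_lt_trans f2.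
apply: ge0_le_integral => //=.
- apply/measurable_EFinP.
  apply: (@measurableT_comp _ _ _ _ _ _ (fun x : R => x `^ 2)%R) => //.
  exact: measurableT_comp.
- by apply/measurable_EFinP; apply: measurableT_comp => //; exact: measurable_funX.
- by move=> x _; rewrite lee_fin powR_mulrn// normrX.
Qed.

(** The core of (1) and (2).  The affine functions are uncorrelated with [f],
    and they have the right flexibility: since [f] crosses its mean at most
    twice, one of them either meets [g] at the crossings or has the sign of
    f - E f. *)
Lemma covariance_quasi_concave_convex_le0 (R : realType)
    (mu : probability (measurableTypeR R) R) (f g : R -> R) :
    (id : R -> R) \in Lfun mu 2%:E ->
    f \in Lfun mu 2%:E -> g \in Lfun mu 2%:E ->
    quasi_concave f -> convex_function [set: R^o] g ->
    covariance mu f id = 0 ->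
  covariance mu f g <= 0.
Proof.
move=> id2 f2 g2 qf cg fx; set m := fine 'E_mu[f].
have one_side (a b : R) : (a, b) != (0, 0)%R ->
    (forall x, 0 <= (f x - m) * (a * x + b))%R -> covariance mu f g <= 0.
  move=> ab s.
  (* - b / a is the zero of the affine function when a is nonzero; when a = 0
     there is no zero and any value would do *)
  rewrite (covariance_eq0_sign mu f g (fun x => a * x + b)%R (g (- b / a)%R))//.
  - exact: Lfun2_affine.
  - exact: covariance_affine_eq0.
  - move=> x /= xab; congr g; have [a0|a0] := eqVneq a 0%R.
      by move: ab xab; rewrite a0 mul0r add0r => /[swap] ->; rewrite eqxx.
    by apply: (mulfI a0); rewrite mulrCA divff// mulr1; lra.
pose I := [set x | (m < f x)%R].
have iI : is_interval I by exact: quasi_concave_is_interval.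
have outI x : ~ I x -> (f x <= m)%R by move=> /negP; rewrite -leNgt.
have inI x y z : I x -> I y -> (x <= z <= y)%R -> I z.
  by move=> Ix Iy; exact: iI Ix Iy z.
have [[x0 Ix0]|/forallNP I0] := pselect (exists x, I x); last first.
  apply: (one_side 0 (- 1))%R; first by rewrite xpair_eqE oppr_eq0 oner_eq0 andbF.
  by move=> x; have := outI x (I0 x); lra.
(* an interval unbounded below (above) has elements below (above) any x *)
have nlb : ~ has_lbound I -> forall x, exists2 y, I y & (y < x)%R.
  move=> nl x; apply: contrapT => h; apply: nl; exists x => y Iy.
  by rewrite leNgt; apply/negP => yx; apply: h; exists y.
have nub : ~ has_ubound I -> forall x, exists2 y, I y & (x < y)%R.
  move=> nu x; apply: contrapT => h; apply: nu; exists x => y Iy.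
  by rewrite leNgt; apply/negP => yx; apply: h; exists y.
have I0 : I !=set0 by exists x0.
have infP x : has_lbound I -> I x -> (inf I <= x)%R.
  by move=> lI Ix; exact: ge_inf.
have supP x : has_ubound I -> I x -> (x <= sup I)%R.
  by move=> uI Ix; exact: ub_le_sup.
have infx x : has_lbound I -> (inf I < x)%R -> exists2 y, I y & (y < x)%R.
  by move=> lI /inf_lt; apply.
have supx x : has_ubound I -> (x < sup I)%R -> exists2 y, I y & (x < y)%R.
  by move=> uI /sup_gt; apply.
have [lI|/nlb lI] := pselect (has_lbound I);
    have [uI|/nub uI] := pselect (has_ubound I).
- have pq : (inf I <= sup I)%R by rewrite (le_trans (infP x0 _ _) (supP x0 _ _)).
  have [a [b ab]] := convex_affine_touching g _ _ cg pq.
  apply: (covariance_le0_sign mu f g (fun x => a * x + b)%R) => //.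
  + exact: Lfun2_affine.
  + exact: covariance_affine_eq0.
  move=> x /=; rewrite -/m; have [abI abO] := ab x.
  have [Ix|nIx] := pselect (I x).
    have kl : (g x <= a * x + b)%R by rewrite abI// infP// supP.
    by rewrite mulr_ge0_le0 ?subr_ge0 ?subr_le0//; exact: ltW.
  rewrite mulr_le0_ge0 ?subr_le0 ?outI// subr_ge0.
  apply: abO.
  have [xp|px] := leP x (inf I); first by left.
  have [qx|xq] := leP (sup I) x; first by right.
  have [y Iy yx] := infx x lI px; have [z Iz xz] := supx x uI xq.
  by case: nIx; apply: inI Iy Iz _; rewrite !ltW.
- apply: (one_side 1 (- inf I))%R; first by rewrite xpair_eqE oner_eq0.
  move=> x; rewrite mul1r; have [Ix|nIx] := pselect (I x).
    by rewrite mulr_ge0 ?subr_ge0 ?infP//; exact: ltW Ix.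
  rewrite mulr_le0 ?subr_le0 ?outI// leNgt; apply/negP => px.
  have [y Iy yx] := infx x lI px; have [z Iz xz] := uI x.
  by case: nIx; apply: inI Iy Iz _; rewrite !ltW.
- apply: (one_side (- 1) (sup I))%R; first by rewrite xpair_eqE oppr_eq0 oner_eq0.
  move=> x; rewrite mulN1r [(- x + _)%R]addrC; have [Ix|nIx] := pselect (I x).
    by rewrite mulr_ge0 ?subr_ge0 ?supP//; exact: ltW Ix.
  rewrite mulr_le0 ?subr_le0 ?outI// leNgt; apply/negP => xq.
  have [y Iy yx] := lI x; have [z Iz xz] := supx x uI xq.
  by case: nIx; apply: inI Iy Iz _; rewrite !ltW.
- apply: (one_side 0 1)%R; first by rewrite xpair_eqE oner_eq0 andbF.
  move=> x; rewrite mul0r add0r mulr1 subr_ge0; apply: ltW.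
  have [y Iy yx] := lI x; have [z Iz xz] := uI x.
  by apply: inI Iy Iz _; rewrite !ltW.
Qed.

Theorem theorem1p2 (R : realType) (mu : probability (measurableTypeR R) R)
    (mu2 : mu.-integrable [set: R] (fun x : R => (x ^+ 2)%:E))
    (f g : R -> R)
    (fL2 : f \in Lfun mu 2%:E) (gL2 : g \in Lfun mu 2%:E) :
  [/\ convex_function [set: R^o] f -> convex_function [set: R^o] g ->
      covariance mu f id * covariance mu g id <=
        'V_mu[id : R -> R] * covariance mu f g,
      log_concave f -> convex_function [set: R^o] g ->
      covariance mu f id = 0 ->
      covariance mu f g <= 0
    & quasi_concave f -> quasi_concave g ->
      even_function f -> even_function g ->
      0 <= covariance mu f g].
Proof.
have id2 : (id : R -> R) \in Lfun mu 2%:E by exact: Lfun2_sqr_integrable.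
split.
- move=> cf cg.
  have cE h k : h \in Lfun mu 2%:E -> k \in Lfun mu 2%:E ->
      exists c : R, covariance mu h k = c%:E.
    by move=> h2 k2; exists (fine (covariance mu h k));
      rewrite fineK// covariance_fin_num2.
  have [v vE] := cE id id id2 id2; have [c fxE] := cE f id fL2 id2.
  have v0 : (0 <= v)%R by rewrite -lee_fin -vE variance_ge0.
  (* c x - v f is concave and, since c v - v c = 0, uncorrelated with x *)
  have h2 := Lfun2_lin mu id f c (- v)%R id2 fL2.
  have qh : quasi_concave (fun x : R => c * x + (- v) * f x)%R.
    by apply: quasi_concave_linear_add_concave; rewrite ?oppr_le0.
  have := covariance_quasi_concave_convex_le0 _ mu _ g id2 h2 gL2 qh cg.
  rewrite !(covariance_linl mu id f)// /variance vE fxE EFinN !mulNe muleC.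
  rewrite subee// => /(_ erefl).
  by rewrite sube_le0 (covarianceC mu g id).
- move=> /log_concave_quasi_concave qf cg fx.
  exact: covariance_quasi_concave_convex_le0.
- move=> qf qg ef eg; apply: covariance_comonotone_ge0 => // x y fxy.
  apply: quasi_concave_even_le => //; rewrite leNgt; apply/negP => xy.
  have := quasi_concave_even_le f x y qf ef (ltW xy).
  by rewrite leNgt fxy.
Qed.
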